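(* For every integer $K\ge 1$, the interval-averaging function family with input set $X=\{0,1,\ldots,K\}$ is computable with constant storage. Moreover, there is an absolute constant $C$ such that for every $K\ge 2$ there is a constant-storage algorithm for interval averaging with input set $\{0,\ldots,K\}$ under which, on every network with $n$ nodes and for all initial values, every node has the correct output $f_n(x_1,\ldots,x_n)$ at all times $t\ge C\,n^2K^2\log K$ (i.e. after $O(n^2K^2\log K)$ rounds of communication).
   Context: Interval averaging: let $X=\{0,\ldots,K\}$ and let $Y=\{\{0\},(0,1),\{1\},(1,2),\ldots,(K-1,K),\{K\}\}$. For each $n$, $f_n:X^n\to Y$ maps $(x_1,\ldots,x_n)$ to the element of $Y$ containing $\frac1n\sum_{i=1}^n x_i$. Model. A network is a triple $(n,G,\mathcal L)$: $G$ is a connected undirected graph (fixed in time, no self-arcs) on $n\ge 2$ nodes $\{1,\ldots,n\}$; $d(i)$ is the degree of node $i$; the port labeling $\mathcal L$ assigns to the edges at each node $i$ distinct port numbers in $\{0,1,\ldots,d(i)\}$, arbitrary and private to $i$. Nodes have no identifiers and no knowledge of $n$ or $G$. An algorithm is a family of deterministic automata $(A_d)_{d=1,2,\ldots}$ with internal memory sets $Z_d$, output set $Y\cup\{\emptyset\}$, and message set $M$, where $A_d$ maps $X\times Z_d\times(Y\cup\{\emptyset\})\times M^d$ into itself, leaving the $X$-component (the initial value) unchanged. Each node $i$ runs $A_{d(i)}$ starting from initial value $x_i\in X$, with memory, output and outgoing messages set to a default symbol $\emptyset$. At each time step (round), node $i$ applies $A_{d(i)}$ to $x_i$, its memory $z_i(t)$,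 its output $y_i(t)$, and the $d(i)$ messages sent to it at time $t$ by its neighbors (listed in the order of its port numbers), obtaining $z_i(t+1)$, $y_i(t+1)$ and one outgoing message for each port. Messages are binary ($M=\{0,1\}$, apart from the default initial symbol). The algorithm is constant-storage if each node stores at most a constant number of bits per link: for fixed $K$ there is a constant $C_K$ (independent of $n$, $d$ and the network) such that each node of degree $d$ uses at most $C_K d$ bits of memory. The family $(f_n)$ is computable with constant storage if there is a constant-storage algorithm such that, for every $n$, every network with $n$ nodes and all initial values, there is a time $t'$ with $y_i(t)=f_n(x_1,\ldots,x_n)$ for all nodes $i$ and all $t\ge t'$ (nodes need not know that this has happened). *)

(* Defs.v *)
From mathcomp Require Import all_boot all_order all_algebra.

Set Implicit Arguments.
Unset Strict Implicit.
Unset Printing Implicit Defensive.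
Import Order.TTheory GRing.Theory Num.Theory.
Local Open Scope ring_scope.

Record graph (n : nat) := Graph {
  adj :> rel 'I_n;
  adj_sym : symmetric adj;
  adj_irrefl : irreflexive adj;
  adj_connected : forall i j, connect adj i j
}.

Definition degree n (G : graph n) (i : 'I_n) : nat := #|[pred j | G i j]|.

(* [port i j] is the number given by node i to the edge {i, j}; its value when
   i and j are not adjacent is irrelevant and never used. *)
Record network (n : nat) := Network {
  net_graph :> graph n;
  net_size : (1 < n)%N;
  port : forall i : 'I_n, 'I_n -> 'I_(degree net_graph i).+1;
  port_inj : forall i, {in [pred j | net_graph i j] &, injective (port i)}
}.

Definition port_le n (N : network n) (i : 'I_n) : rel 'I_n :=
  fun j k => (port N i j <= port N i k)%N.

Definition port_seq n (N : network n) (i : 'I_n) : seq 'I_n :=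
  sort (port_le N i) (enum [pred j | N i j]).

Lemma size_port_seq n (N : network n) i : size (port_seq N i) == degree N i.
Proof. by rewrite size_sort -cardE. Qed.

Canonical port_tuple n (N : network n) i : (degree N i).-tuple 'I_n :=
  Tuple (size_port_seq N i).

Lemma mem_port_seq n (N : network n) i j : (j \in port_seq N i) = N i j.
Proof. by rewrite mem_sort mem_enum inE. Qed.

Lemma port_seq_uniq n (N : network n) i : uniq (port_seq N i).
Proof. by rewrite sort_uniq enum_uniq. Qed.

(* [memory A d] is Z_d, and [memory0 A d] is the default symbol of Z_d. Outputs are
   in Y + {None} and messages in {0,1} + {None}, with None the default symbol;
   a message emitted by a transition is a genuine bit, so that None occurs as a
   message only at time 0. A transition is given the initial value but does not
   return it, since it cannot change. Only the components with d > 0 are ever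
   run, because the networks are connected with at least two nodes. *)
Record algorithm (X Y : Type) := Algorithm {
  memory : nat -> Type;
  memory0 : forall d, memory d;
  trans : forall d, X -> memory d -> option Y -> d.-tuple (option bool) ->
          memory d * option Y * d.-tuple bool
}.

Record state (X Y : Type) (A : algorithm X Y) (d : nat) := State {
  st_mem : memory A d;
  st_out : option Y;
  st_msg : d.-tuple (option bool)
}.

Section Execution.
Variables (X Y : Type) (A : algorithm X Y) (n : nat) (N : network n).

Definition configuration := forall i : 'I_n, state A (degree N i).

Definition init_conf : configuration :=
  fun i => State (memory0 A _) None [tuple None | _ < degree N i].

(* The default of [nth] is not reached when j and i are adjacent. *)
Definition sent (c : configuration) (j i : 'I_n) : option bool :=
  nth None (st_msg (c j)) (index i (port_seq N j)).

Definition received (c : configuration) (i : 'I_n) :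
    (degree N i).-tuple (option bool) :=
  [tuple of [seq sent c j i | j <- port_tuple N i]].

Definition step (x : {ffun 'I_n -> X}) (c : configuration) : configuration :=
  fun i =>
    let: (z, y, m) :=
      trans (x i) (st_mem (c i)) (st_out (c i)) (received c i) in
    State z y [tuple of [seq Some b | b <- m]].

Definition conf_at (x : {ffun 'I_n -> X}) (t : nat) : configuration :=
  iter t (step x) init_conf.

Definition output_at (x : {ffun 'I_n -> X}) (t : nat) (i : 'I_n) : option Y :=
  st_out (conf_at x t i).

End Execution.

Definition computes (X Y : Type) (A : algorithm X Y)
    (f : forall n, {ffun 'I_n -> X} -> Y) : Prop :=
  forall n (N : network n) (x : {ffun 'I_n -> X}),
    exists t', forall t, (t' <= t)%N ->
      forall i, output_at A N x t i = Some (f n x).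

(* The memory of a node of degree d can be encoded by C * d bits. *)
Definition constant_storage (X Y : Type) (A : algorithm X Y) : Prop :=
  exists C : nat, forall d, (0 < d)%N ->
    exists enc : memory A d -> (C * d).-tuple bool, injective enc.

Definition computable_with_constant_storage (X Y : Type)
    (f : forall n, {ffun 'I_n -> X} -> Y) : Prop :=
  exists A : algorithm X Y, constant_storage A /\ computes A f.

(* The set {{0}, (0,1), {1}, ..., (K-1,K), {K}}: [inl k] stands for {k} and
   [inr k] for (k, k+1), as made explicit by [cell_itv]. *)
Definition cell (K : nat) := ('I_K.+1 + 'I_K)%type.

Definition cell_itv K (y : cell K) : interval rat :=
  match y with
  | inl k => `[k%:R, k%:R]
  | inr k => `]k%:R, k.+1%:R[
  end.

Definition average K n (x : {ffun 'I_n -> 'I_K.+1}) : rat :=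
  (\sum_(i < n) (x i)%:R) / n%:R.

Lemma average_cell K n (x : {ffun 'I_n -> 'I_K.+1}) :
  exists y : cell K, average x \in cell_itv y.
Proof.
case: (posnP n) => [n0|n_gt0].
  exists (inl ord0); subst n.
  by rewrite /average big_ord0 mul0r in_itv /= lexx.
have nq : 0 < n%:R :> rat by rewrite ltr0n.
set s := (\sum_(i < n) (x i : nat))%N.
have sK : (s <= K * n)%N.
  have -> : (K * n = \sum_(i < n) K)%N.
    by rewrite sum_nat_const card_ord mulnC.
  by apply: leq_sum => i _; rewrite -ltnS.
have -> : average x = s%:R / n%:R by rewrite /average natr_sum.
have [dvd|ndvd] := boolP (n %| s)%N.
  have lt : (s %/ n < K.+1)%N.
    by rewrite ltnS -(mulnK K n_gt0) leq_div2r.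
  exists (inl (Ordinal lt)); rewrite in_itv /= -eq_le eq_sym.
  by rewrite -[X in X%:R / _](divnK dvd) natrM mulfK // gt_eqF.
have lt : (s %/ n < K)%N.
  rewrite ltn_divLR // ltn_neqAle sK andbT.
  by apply: contraNneq ndvd => ->; rewrite dvdn_mull.
exists (inr (Ordinal lt)).
rewrite in_itv /= ltr_pdivlMr // ltr_pdivrMr // -!natrM !ltr_nat.
rewrite -ltn_divLR // leqnn andbT ltn_neqAle leq_divM andbT.
by apply: contraNneq ndvd => <-; rewrite dvdn_mull.
Qed.

Lemma cell_unique K (a : rat) (y y' : cell K) :
  a \in cell_itv y -> a \in cell_itv y' -> y = y'.
Proof.
case: y y' => [k|k] [l|l]; rewrite !in_itv /= => /andP[h1 h2] /andP[h3 h4].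
- congr inl; apply/val_inj/eqP; rewrite eqn_leq -!(ler_nat rat).
  by rewrite (le_trans h1 h4) (le_trans h3 h2).
- have := lt_le_trans h3 h2; have := le_lt_trans h1 h4.
  by rewrite !ltr_nat ltnS leqNgt => /negPf->.
- have := lt_le_trans h1 h4; have := le_lt_trans h3 h2.
  by rewrite !ltr_nat ltnS leqNgt => /negPf->.
- congr inr; apply/val_inj/eqP; rewrite eqn_leq.
  have := lt_trans h1 h4; have := lt_trans h3 h2.
  by rewrite !ltr_nat !ltnS => -> ->.
Qed.

Definition interval_avg K n (x : {ffun 'I_n -> 'I_K.+1}) : cell K :=
  xchoose (average_cell x).

Lemma interval_avgP K n (x : {ffun 'I_n -> 'I_K.+1}) (y : cell K) :
  average x \in cell_itv y <-> interval_avg x = y.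
Proof.
split=> [h|<-]; last exact: (xchooseP (average_cell x)).
exact: cell_unique (xchooseP (average_cell x)) h.
Qed.

(* Main.v *)
Require Import Defs.
From HB Require Import structures.
From mathcomp Require Import all_boot all_order all_algebra.
From mathcomp Require Import zify ring.
From mathcomp Require Import reals exp.

Set Implicit Arguments.
Unset Strict Implicit.
Unset Printing Implicit Defensive.
Import Order.TTheory GRing.Theory Num.Theory.

(** Comparing the average with every k in {0,...,K} amounts to deciding, for
    loads u_i (either x_i or K - x_i) and a threshold theta <= K, whether
    sum u_i < n theta. The 2K+2 such queries are answered by one protocol, run
    in time multiplexing.

    In this protocol the nodes of load < theta are sources. Every node has a
    clock, initially 0, which advances when the node is a source or when some
    neighbor is ahead. Clocks of neighbors differ by at most 1, so it suffices
    to communicate them modulo 3. While the set of sources does not change, the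
    clock at distance D of that set eventually reads t - D, so that being ahead
    means being closer to a source. A node of load > theta passes one unit to
    a neighbor which is ahead and has load <= theta. The set of sources only
    shrinks and, as long as there are both sources and loads > theta, some unit
    is absorbed by a source within O(n) steps; hence after O(n * nK) steps one
    of the two kinds is extinct. If a source survives, all clocks advance
    forever; otherwise they all stop within n steps. So whether its clock has just
    advanced eventually tells each node whether sum u_i < n theta. *)

(** * One query: the idealised dynamics with unbounded clocks *)

Section Dynamics.
Variables (n : nat) (N : network n) (theta : nat) (u0 : 'I_n -> nat).
Implicit Types (u h : 'I_n -> nat) (i j : 'I_n) (t : nat).

Definition neighbor i (k : 'I_(degree N i)) : 'I_n := tnth (port_tuple N i) k.

Lemma neighbor_adj i k : N i (neighbor (i := i) k).
Proof. by rewrite -mem_port_seq mem_tnth. Qed.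

Lemma adj_neighbor i j : N i j -> exists k : 'I_(degree N i), j = neighbor k.
Proof. by rewrite -mem_port_seq => /(tnthP (port_tuple N i)). Qed.

Lemma net_sym i j : N i j = N j i.
Proof. exact: adj_sym. Qed.

(** The receiver is picked among ports, not nodes, so that [phase] makes the same choice from what
    node [i] can see. *)
Definition target u h i : option 'I_n :=
  if theta < u i then
    omap (@neighbor i) [pick k | (h (neighbor k) == (h i).+1) && (u (neighbor k) <= theta)]
  else None.

Definition rising u h i : bool :=
  (u i < theta) || [exists k : 'I_(degree N i), h (neighbor k) == (h i).+1].

Definition arrivals u h i : nat := #|[pred j | target u h j == Some i]|.

Definition next (c : ('I_n -> nat) * ('I_n -> nat)) :=
  (fun i => c.1 i - target c.1 c.2 i + arrivals c.1 c.2 i,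
   fun i => c.2 i + rising c.1 c.2 i).

Definition load t := (iter t next (u0, fun=> 0)).1.
Definition height t := (iter t next (u0, fun=> 0)).2.
Definition rises t i := rising (load t) (height t) i.
Definition dest t := target (load t) (height t).

Lemma loadS t i : load t.+1 i = load t i - dest t i + arrivals (load t) (height t) i.
Proof. by []. Qed.

Lemma heightS t i : height t.+1 i = height t i + rises t i.
Proof. by []. Qed.

Lemma risesP t i :
  reflect (load t i < theta \/ exists2 j, N i j & height t j = (height t i).+1)
          (rises t i).
Proof.
apply: (iffP orP) => [[->|/existsP[k /eqP hk]]|[->|[j ij hj]]]; first by left.
- by right; exists (neighbor k) => //; exact: neighbor_adj.
- by left.
- by have [k jk] := adj_neighbor ij; right; apply/existsP; exists k; rewrite -jk hj.
Qed.

Lemma destP t i j : dest t i = Some j ->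
  [/\ theta < load t i, N i j, height t j = (height t i).+1 & load t j <= theta].
Proof.
rewrite /dest /target; case: ifP => // ui; case: pickP => //= k /andP[/eqP hk uk] [<-].
by split=> //; exact: neighbor_adj.
Qed.

Lemma dest_exists t i j : theta < load t i -> N i j ->
  height t j = (height t i).+1 -> load t j <= theta -> exists j', dest t i = Some j'.
Proof.
move=> ui ij hj uj; rewrite /dest /target ui; have [k jk] := adj_neighbor ij.
by case: pickP => [k' _|/(_ k)]; [exists (neighbor k') | rewrite -jk hj eqxx uj].
Qed.

Lemma dest_None t i : load t i <= theta -> dest t i = None.
Proof. by case E: (dest t i) => [j|] //; case/destP: E => lt _ _ _; lia. Qed.

Lemma dest_le_load t i : (dest t i : nat) <= load t i.
Proof. by case E: (dest t i) => [j|] //; case/destP: E => lt _ _ _ /=; lia. Qed.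

Lemma arrivals0 t i : theta < load t i -> arrivals (load t) (height t) i = 0.
Proof.
move=> ui; apply: eq_card0 => j; rewrite !inE; apply/negP => /eqP /destP[_ _ _].
by lia.
Qed.

Lemma arrivals_le_degree u h i : arrivals u h i <= degree N i.
Proof.
apply/subset_leq_card/subsetP => j; rewrite !inE /target.
case: ifP => // _; case: pickP => //= k _ /eqP[<-]; rewrite -/(N i _) net_sym.
exact: neighbor_adj.
Qed.

(** Only nodes of load at most [theta] receive, at most one unit per edge and step. This makes the
    load a bounded counter. *)
Lemma load_bound K t i : theta <= K -> (forall j, u0 j <= K) ->
  load t i <= K + degree N i.
Proof.
move=> thK u0K; elim: t => [|t IH]; first by apply: leq_trans (u0K i) _; lia.
rewrite loadS; have := arrivals_le_degree (load t) (height t) i.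
by case: (leqP (load t i) theta) => [|/arrivals0 ->]; lia.
Qed.

Lemma sum_load t : \sum_i load t i = \sum_i u0 i.
Proof.
elim: t => // t <-.
have -> : \sum_i load t.+1 i =
    \sum_i (load t i - dest t i) + \sum_i arrivals (load t) (height t) i.
  by rewrite -big_split.
have -> : \sum_i arrivals (load t) (height t) i = \sum_i (dest t i : nat).
  rewrite (eq_bigr (fun i => \sum_j (dest t j == Some i : nat))); last first.
    by move=> i _; rewrite /arrivals -sum1_card big_mkcond /=; apply: eq_bigr.
  rewrite exchange_big; apply: eq_bigr => j _.
  case: (dest t j) => [k|] /=; last by rewrite big1.
  by rewrite (bigD1 k) //= eqxx big1 // => i /negPf ik; rewrite eq_sym [_ == _]ik.
rewrite -big_split; apply: eq_bigr => i _ /=; exact/subnK/dest_le_load.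
Qed.

(** * Deficits never grow, and clocks stay close to each other *)

Lemma deficitS t i : theta - load t.+1 i <= theta - load t i.
Proof.
rewrite loadS; case E: (dest t i) => [j|] /=; last by lia.
(* A sender is above [theta], so it has no deficit even after losing one unit. *)
by case/destP: E => lt _ _ _; lia.
Qed.

Lemma deficit_le s t i : s <= t -> theta - load t i <= theta - load s i.
Proof.
move=> /subnK <-; elim: (t - s) => // m IH.
exact: leq_trans (deficitS _ _) IH.
Qed.

Lemma source_le s t i : s <= t -> load t i < theta -> load s i < theta.
Proof. by move=> st; have := deficit_le i st; lia. Qed.

Lemma height_le t i : height t i <= t.
Proof. by elim: t => // t IH; rewrite heightS; case: (rises t i); lia. Qed.

Lemma height_source t i : load t i < theta -> height t i = t.
Proof.
elim: t => // t IH ut; have us := source_le (leqnSn t) ut.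
by rewrite heightS (IH us) [rises t i](introT (risesP t i) (or_introl us)) addn1.
Qed.

(** If [j] is one ahead, then [i] advances too; otherwise one step can put [j] at most one ahead. *)
Lemma height_lipschitz t i j : N i j -> height t j <= (height t i).+1.
Proof.
move=> ij; elim: t => // t IH; rewrite !heightS.
case: (eqVneq (height t j) (height t i).+1) => [hj|hj]; last by case: (rises t j); lia.
have -> : rises t i by apply/risesP; right; exists j.
by case: (rises t j); lia.
Qed.

Lemma height_spread t i j : N i j -> height t j <= height t.+1 i.
Proof.
move=> ij; have := height_lipschitz t ij; rewrite heightS leq_eqVlt => /orP[/eqP hj|].
  by have -> : rises t i by [apply/risesP; right; exists j]; lia.
by lia.
Qed.

Lemma height_mono s t i : s <= t -> height s i <= height t i.
Proof.
by move=> /subnK <-; elim: (t - s) => // m IH; rewrite addSn heightS; lia.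
Qed.

Lemma short_path i j : exists p, [/\ path N i p, last i p = j & size p < n].
Proof.
have /connectP[p /shortenP[p' pp' up' _] ->] := adj_connected N i j.
exists p'; split=> //.
by have /= := max_card (mem (i :: p')); rewrite (card_uniqP up') card_ord.
Qed.

Lemma height_lipschitz_global t i j : height t j < height t i + n.
Proof.
have [p [pp <- sz]] := short_path i j; apply: (@leq_ltn_trans (height t i + size p)); last by lia.
elim: p i pp {sz} => [|k p IH] i /=; first by lia.
by move=> /andP[ik /IH]; have := height_lipschitz t ik; lia.
Qed.

Lemma height_spread_global t i j : height t j <= height (t + n) i.
Proof.
have [p [pp <- sz]] := short_path i j.
apply: (@leq_trans (height (t + size p) i)); last by apply: height_mono; lia.
elim: p i pp {sz} => [|k p IH] i /=; first by rewrite addn0.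
by move=> /andP[ik /IH h]; rewrite addnS; apply: leq_trans (height_spread _ ik).
Qed.

(* In a time window during which no source disappears, a clock value exceeding
   the starting time was emitted within the window, and the whole chain of
   nodes that relayed it keeps rising. *)
Lemma rises_window s e t i :
    (forall t i, s <= t <= e -> load s i < theta -> load t i < theta) ->
  s <= t <= e -> s < height t i -> rises t i.
Proof.
move=> static /andP[/subnK <-]; elim: (t - s) i => [|m IH] i te h_gt.
  by move: h_gt; rewrite add0n ltnNge height_le.
rewrite addSn in te h_gt *.
have {}IH j : s < height (m + s) j -> rises (m + s) j by apply: IH; lia.
move: h_gt; rewrite heightS.
(* Had [i] not just risen, its clock would already have exceeded [s], and induction would have made
   it rise. *)
have [|Ni] := boolP (rises _ i); last by rewrite addn0 => /IH; rewrite (negPf Ni).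
case/risesP=> [us|[j ij hj]].
  move=> _; apply/risesP; left; apply: static; first by lia.
  by apply: source_le us; lia.
(* By induction [j] rose together with [i], so it is still one ahead. *)
rewrite addn1 -hj => /IH rj; apply/risesP; right; exists j => //.
by rewrite !heightS rj hj (introT (risesP _ _)) ?addn1 //; right; exists j.
Qed.

(* The loads above [theta] move one step closer to the sources at each time,
   until one of them is absorbed. *)
Lemma deficit_decr s i0 j0 : load s j0 < theta -> theta < load (s + n.*2.+2) i0 ->
  \sum_i (theta - load (s + n.*2.+2) i) < \sum_i (theta - load s i).
Proof.
move=> src0 pos0; rewrite ltnNge; apply/negP => D_le.
set e := s + n.*2.+2 in pos0 D_le.
have const t i : s <= t <= e -> theta - load t i = theta - load s i.
  move=> /andP[st te]; apply/eqP; rewrite eqn_leq deficit_le //=.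
  apply: leq_trans (deficit_le i te); move: D_le; apply: contraTT.
  rewrite -!ltnNge => lt; rewrite (bigD1 i) //= [X in _ < X](bigD1 i) //=.
  apply: (leq_trans (n := (theta - load e i).+1 + \sum_(j < n | j != i) (theta - load s j))).
    rewrite addSn ltnS leq_add2l; apply: leq_sum => j _; apply: deficit_le; lia.
  by rewrite leq_add2r.
have static t i : s <= t <= e -> load s i < theta -> load t i < theta.
  by move=> te; have := const _ i te; lia.
(* Load plus deficit is [maxn theta load]. Its sum is constant in the window and, because of [i0],
   exceeds [n * theta] at time [e]. *)
have pos t : s <= t <= e -> exists i, theta < load t i.
  move=> te; apply/existsP/contraT => /existsPn npos.
  have eqD : \sum_i (theta - load t i) = \sum_i (theta - load e i).
    by apply: eq_bigr => i _; rewrite !const //; lia.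
  have : \sum_i load t i + \sum_i (theta - load t i) = \sum_(i < n) theta.
    by rewrite -big_split; apply: eq_bigr => i _ /=; have := npos i; lia.
  rewrite eqD sum_load -(sum_load e) -big_split /=.
  have -> : \sum_(i < n) (load e i + (theta - load e i)) = \sum_(i < n) maxn theta (load e i).
    by apply: eq_bigr => i _; lia.
  move=> Emax; have : \sum_(i < n) theta < \sum_(i < n) maxn theta (load e i).
    rewrite (bigD1 i0) //= [X in _ < X](bigD1 i0) //= -addSn.
    by apply: leq_add; [lia | apply: leq_sum => i _; lia].
  by rewrite Emax ltnn.
have src t : s <= t <= e -> height t j0 = t.
  by move=> te; apply/height_source/static.
have climb t i : s + n <= t <= e -> rises t i.
  move=> te; apply: (rises_window static); first by lia.
  have := height_lipschitz_global t i j0.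
  by rewrite (src t); lia.
(* Some clock of a node above [theta] lags behind the time by at most [n - k]; at [k = n + 1] this
   is absurd. *)
have close k : k <= n.+1 -> exists2 i, theta < load (s + n + k) i &
    s + n + k + k <= height (s + n + k) i + n.
  elim: k => [|k IH] kn.
    have [|i ui] := pos (s + n); first by lia.
    exists i; rewrite ?addn0 //.
    have := height_lipschitz_global (s + n) i j0.
    by rewrite (src (s + n)); lia.
  have [|i1 u1 h1] := IH; first by lia.
  set t := s + n + k in u1 h1.
  (* By maximality, a neighbor ahead of [i] cannot be above [theta], so [i] does send a unit. *)
  case: (@arg_maxnP _ i1 [pred i | theta < load t i] (height t) u1) => i /= ui max_i.
  have hi := max_i _ u1.
  have ri : rises t i by apply: climb; lia.
  case/risesP: (ri) => [|[j ij hj]]; first by lia.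
  have uj : load t j <= theta.
    by rewrite leqNgt; apply/negP => /max_i; rewrite hj; lia.
  have [j' /[dup] destj' /destP[_ _ hj' uj']] := dest_exists ui ij hj uj.
  have arr : 0 < arrivals (load t) (height t) j'.
    by apply/card_gt0P; exists i; rewrite inE -[target _ _ _]/(dest t i) destj'.
  have := loadS t j'; rewrite dest_None // subn0 => lS.
  have -> : s + n + k.+1 = t.+1 by rewrite addnS.
  exists j'.
    (* A deficit at [j'] would shrink on receiving the unit. As deficits are constant, it was 0, and
       [j'] is now above [theta]. *)
    have := const t j'; have := const t.+1 j'.
    by lia.
  by rewrite heightS climb; lia.
have [//|i ui hi] := close n.+1.
by have := height_le (s + n + n.+1) i; lia.
Qed.

(** * Convergence of one query *)

Lemma balanced_eventually K : theta <= K ->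
  exists2 s, s <= n.*2.+2 * (n * K).+1 &
    (forall i, theta <= load s i) \/ (forall i, load s i <= theta).
Proof.
move=> thK.
have D0 : \sum_i (theta - load 0 i) <= n * K.
  by rewrite -[n in _ <= n * _]card_ord -sum_nat_const; apply: leq_sum => i _; lia.
(* Each window of [2n + 2] steps contains a balanced moment or lowers the total deficit, initially
   at most [n * K]. *)
suff main m : (exists2 s, s <= n.*2.+2 * m &
      (forall i, theta <= load s i) \/ (forall i, load s i <= theta)) \/
    \sum_i (theta - load (n.*2.+2 * m) i) + m <= \sum_i (theta - load 0 i).
  by have [//|] := main (n * K).+1; lia.
elim: m => [|m [[s sm bal]|IH]]; first by right; rewrite muln0 addn0.
  by left; exists s => //; rewrite mulnS; lia.
rewrite mulnS addnC.
have [/existsP[j src]|/existsPn nsrc] := boolP [exists j, load (n.*2.+2 * m) j < theta]; last first.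
  left; exists (n.*2.+2 * m); first by lia.
  by left=> i; have := nsrc i; lia.
have [/existsP[i pos]|/existsPn npos] := boolP [exists i, theta < load (n.*2.+2 * m + n.*2.+2) i].
  by right; have := deficit_decr src pos; lia.
by left; exists (n.*2.+2 * m + n.*2.+2) => //; right=> i; have := npos i; lia.
Qed.

Lemma sum_theta : \sum_(i < n) theta = n * theta.
Proof. by rewrite sum_nat_const card_ord. Qed.

(** Without sources a clock only follows a higher one, so the maximum at time [s] is never exceeded;
    all clocks reach it within [n] steps. *)
Lemma rises_no_source s t i : (forall i, theta <= load s i) -> s + n <= t ->
  rises t i = false.
Proof.
move=> nsrc st.
case: (@arg_maxnP _ i predT (height s) isT) => j _ max_j.
have bound m k : height (s + m) k <= height s j.
  elim: m k => [|m IH] k; first by rewrite addn0; apply: max_j.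
  rewrite addnS heightS; have [|_] := boolP (rises _ k); last by rewrite addn0.
  case/risesP => [|[k' _ hk']]; last by rewrite addn1 -hk'.
  by move/(source_le (leq_addr _ _)); rewrite ltnNge nsrc.
apply/negP => ri; have := bound (t.+1 - s) i; rewrite subnKC; last by lia.
rewrite heightS ri; have := height_spread_global s i j; have := height_mono i st; lia.
Qed.

Lemma load_static s m i : (forall i, load s i <= theta) -> load (s + m) i = load s i.
Proof.
move=> npos; elim: m i => [|m IH] i; first by rewrite addn0.
rewrite addnS loadS dest_None ?IH ?npos // subn0 /arrivals eq_card0 ?addn0 // => j.
by rewrite !inE -/(dest (s + m)) dest_None // IH.
Qed.

Lemma rises_eventually K t i : theta <= K -> n.*2.+2 * (n * K).+1 + n <= t ->
  rises t i = (\sum_i u0 i < n * theta).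
Proof.
move=> thK t_ge; have [s s_le bal] := balanced_eventually thK.
have st : s + n <= t by lia.
rewrite -(sum_load s) -sum_theta.
have noS : (forall i, theta <= load s i) ->
    rises t i = (\sum_i load s i < \sum_(i < n) theta).
  move=> nsrc; rewrite (rises_no_source i nsrc st); apply/esym/negbTE.
  by rewrite -leqNgt; apply: leq_sum.
case: bal => [//|npos].
have [/existsP[j src]|/existsPn nsrc] := boolP [exists j, load s j < theta]; last first.
  by apply: noS => k; have := nsrc k; lia.
have -> : \sum_i load s i < \sum_(i < n) theta.
  rewrite (bigD1 j) //= [X in _ < X](bigD1 j) //= -addSn.
  by apply: leq_add => //; apply: leq_sum.
have static t' k : s <= t' <= t -> load s k < theta -> load t' k < theta.
  by move=> /andP[/subnKC <- _]; rewrite load_static.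
(* The clock of the lasting source [j] reads [t]; all others lag by less than [n], hence exceed
   [s]. *)
apply: (rises_window static); first by lia.
have := height_lipschitz_global t i j; rewrite (@height_source t j); first by lia.
by apply: static => //; lia.
Qed.

End Dynamics.

(** * Finite-state implementation of one query with binary messages *)

Record query_state (K d : nat) := QueryState {
  cs_load : 'I_(K + d).+1;
  cs_clock : 'I_3;
  cs_bit0 : d.-tuple bool;
  cs_bit1 : d.-tuple bool;
  cs_rise : bool
}.

Definition clock_of (b0 b1 : bool) : nat := if b0 then 0 else if b1 then 1 else 2.

(* Clocks of neighbors differ by at most 1, so that sending them modulo 3
   determines their order. *)
Definition phase K d (theta r : nat) (s : query_state K d) (rec : d.-tuple bool) :
    query_state K d * d.-tuple bool :=
  let: QueryState u h b0 b1 a := s in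
  match r with
  | 0 => (s, [tuple (h == 0 :> nat) | _ < d])
  | 1 => (QueryState u h rec b1 a, [tuple (h == 1 :> nat) | _ < d])
  | 2 => (QueryState u h b0 rec a, [tuple (u <= theta) | _ < d])
  | 3 =>
    let up k := clock_of (tnth b0 k) (tnth b1 k) == h.+1 %% 3 in
    let tgt := if theta < u then [pick k | up k && tnth rec k] else None in
    let inc := (u < theta) || [exists k, up k] in
    (QueryState (inord (u - tgt)) (inord ((h + inc) %% 3)) b0 b1 inc,
     [tuple (tgt == Some k) | k < d])
  | _ => (QueryState (inord (u + count id rec)) h b0 b1 a, [tuple false | _ < d])
  end.

(** * Five phases simulate one step of the dynamics *)

Section Instance.
Variables (n : nat) (N : network n) (K theta : nat) (u0 : 'I_n -> nat).
Hypotheses (theta_le : theta <= K) (u0_le : forall i, u0 i <= K).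

Notation load := (load N theta u0).
Notation height := (height N theta u0).
Notation rises := (rises N theta u0).
Notation dest := (dest N theta u0).

Definition say i (f : 'I_n -> bool) : (degree N i).-tuple (option bool) :=
  [tuple of [seq Some (f j) | j <- port_tuple N i]].

Definition heard i (f : 'I_n -> bool) : (degree N i).-tuple bool :=
  [tuple of [seq f j | j <- port_tuple N i]].

Definition rest T i (s : query_state K (degree N i)) : Prop :=
  [/\ cs_load s = load T i :> nat, cs_clock s = height T i %% 3 :> nat &
      0 < T -> cs_rise s = rises T.-1 i].

(** The situation just before phase [r] of step [T], where [m] was sent by the preceding phase.
    Phase 0 ignores what it hears, so [m] is then arbitrary. Before phase 4 the clock has advanced
    and the sent unit is gone, but arrivals are not yet added. *)
Definition stage T r i (s : query_state K (degree N i))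
    (m : (degree N i).-tuple (option bool)) : Prop :=
  match r with
  | 0 => rest T s
  | 1 => rest T s /\ m = say i (fun=> height T i %% 3 == 0)
  | 2 => [/\ rest T s, cs_bit0 s = heard i (fun j => height T j %% 3 == 0) &
             m = say i (fun=> height T i %% 3 == 1)]
  | 3 => [/\ rest T s, cs_bit0 s = heard i (fun j => height T j %% 3 == 0),
             cs_bit1 s = heard i (fun j => height T j %% 3 == 1) &
             m = say i (fun=> load T i <= theta)]
  | _ => [/\ cs_load s = load T i - dest T i :> nat,
             cs_clock s = height T.+1 i %% 3 :> nat,
             cs_rise s = rises T i & m = say i (fun j => dest T i == Some j)]
  end.

Definition listen d (m : d.-tuple (option bool)) : d.-tuple bool :=
  [tuple of [seq o == Some true | o <- m]].

Definition utter d (m : d.-tuple bool) : d.-tuple (option bool) :=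
  [tuple of [seq Some b | b <- m]].

(* [received], as a function of the message components alone. *)
Definition gather (m : forall i, (degree N i).-tuple (option bool)) i :
    (degree N i).-tuple (option bool) :=
  [tuple of [seq nth None (m j) (index i (port_seq N j)) | j <- port_tuple N i]].

Lemma listen_gather m (f : 'I_n -> 'I_n -> bool) i :
  (forall j, m j = say j (f j)) -> listen (gather m i) = heard i (fun j => f j i).
Proof.
move=> mE; apply: eq_from_tnth => k; rewrite !tnth_map mE.
rewrite -/(neighbor k); set j := neighbor k.
have ij : i \in port_seq N j by rewrite mem_port_seq net_sym neighbor_adj.
by rewrite (nth_map i) ?index_mem // nth_index //; case: (f j i).
Qed.

Lemma clock_ofP a : clock_of (a %% 3 == 0) (a %% 3 == 1) = a %% 3.
Proof. by have := ltn_pmod a (isT : 0 < 3); case: (a %% 3) => [|[|[|]]]. Qed.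

Lemma up_mod3 T i k :
  (height T (@neighbor n N i k) %% 3 == (height T i %% 3).+1 %% 3) =
  (height T (neighbor k) == (height T i).+1).
Proof.
have ij := neighbor_adj k; have := height_lipschitz theta u0 T ij.
have := height_lipschitz theta u0 T (etrans (net_sym N _ _) ij).
by move=> h1 h2; apply/eqP/eqP; lia.
Qed.

Lemma count_heard T i : count id (heard i (fun j => dest T j == Some i)) =
  arrivals N theta (load T) (height T) i.
Proof.
rewrite /= count_map -size_filter -(card_uniqP _) ?filter_uniq ?port_seq_uniq //.
apply: eq_card => j; rewrite !inE mem_filter mem_port_seq /=.
rewrite -/(dest T j) andb_idr // => /eqP /destP[_ ji _ _]; by rewrite net_sym.
Qed.

Lemma say_tuple i (f : 'I_n -> bool) (m : (degree N i).-tuple bool) :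
  (forall k, tnth m k = f (neighbor k)) -> utter m = say i f.
Proof. by move=> mE; apply: eq_from_tnth => k; rewrite !tnth_map mE. Qed.

(** The output is read at every phase: the stored bit dates from step [T - 1] up to [r = 3], and
    from step [T] afterwards. *)
Lemma stage_rise T r i (s : query_state K (degree N i)) m : 0 < T ->
  stage T r s m -> exists2 t, T.-1 <= t & cs_rise s = rises t i.
Proof.
move=> T0; case: r => [|[|[|[|r]]]] /=.
- by case=> _ _ aE; exists T.-1; rewrite ?aE.
- by case=> [[_ _ aE] _]; exists T.-1; rewrite ?aE.
- by case=> [[_ _ aE] _ _]; exists T.-1; rewrite ?aE.
- by case=> [[_ _ aE] _ _ _]; exists T.-1; rewrite ?aE.
- by case=> _ _ aE _; exists T; rewrite ?leq_pred.
Qed.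

Lemma stage_phase T r i (s : forall j, query_state K (degree N j)) m :
  (forall j, stage T r (s j) (m j)) ->
  let p := phase theta r (s i) (listen (gather m i)) in
  if r < 4 then stage T r.+1 p.1 (utter p.2) else rest T.+1 p.1.
Proof.
(* This bound makes every [inord] applied to a load exact. *)
have uK T' j : load T' j < (K + degree N j).+1 by rewrite ltnS load_bound.
case: r => [|[|[|[|r]]]] /= st.
- have [uE hE aE] := st i; case: (s i) uE hE aE => u h b0 b1 a /= uE hE aE.
  by split=> //; apply: say_tuple => k; rewrite tnth_map hE.
- rewrite (listen_gather (f := fun j _ => height T j %% 3 == 0)); last by move=> j; case: (st j).
  have [[uE hE aE] _] := st i; case: (s i) uE hE aE => u h b0 b1 a /= uE hE aE.
  by split=> //; apply: say_tuple => k; rewrite tnth_map hE.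
- rewrite (listen_gather (f := fun j _ => height T j %% 3 == 1)); last by move=> j; case: (st j).
  have [[uE hE aE] b0E _] := st i.
  case: (s i) uE hE aE b0E => u h b0 b1 a /= uE hE aE b0E.
  by split=> //; apply: say_tuple => k; rewrite tnth_map uE.
- rewrite (listen_gather (f := fun j _ => load T j <= theta)); last by move=> j; case: (st j).
  have [[uE hE aE] b0E b1E _] := st i.
  case: (s i) uE hE aE b0E b1E => u h b0 b1 a /= uE hE aE -> ->.
  have upE k : clock_of (tnth (heard i (fun j => height T j %% 3 == 0)) k)
      (tnth (heard i (fun j => height T j %% 3 == 1)) k) == h.+1 %% 3 =
      (height T (neighbor k) == (height T i).+1).
    by rewrite !tnth_map clock_ofP hE; exact: up_mod3.
  have incE : (u < theta) || [exists k, clock_of (tnth (heard i (fun j => height T j %% 3 == 0)) k)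
      (tnth (heard i (fun j => height T j %% 3 == 1)) k) == h.+1 %% 3] = rises T i.
    by rewrite uE; congr (_ || _); apply: eq_existsb => k; rewrite upE.
  rewrite incE.
  set tgt := if _ then _ else _.
  have tgtE : dest T i = omap (@neighbor n N i) tgt.
    rewrite /dest /target /tgt uE; case: ifP => // _; congr omap.
    by apply: eq_pick => k; rewrite upE tnth_map.
  split=> //.
  + rewrite tgtE inordK; first by case: (tgt); rewrite uE.
    by have := uK T i; case: (tgt) => [?|]; lia.
  + rewrite heightS inordK ?ltn_pmod // hE modnDml //.
  + apply: say_tuple => k; rewrite tnth_map tnth_ord_tuple tgtE.
    case: (tgt) => [k'|] //=.
    apply/eqP/eqP => [[->] //|[] /(tuple_uniqP _ (port_seq_uniq N i)) -> //].
- rewrite (listen_gather (f := fun j k => dest T j == Some k)); last by move=> j; case: (st j).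
  have [uE hE aE _] := st i.
  case: (s i) uE hE aE => u h b0 b1 a /= uE hE aE.
  have lE := loadS N theta u0 T i.
  by rewrite count_heard; split=> //=; rewrite inordK uE -lE.
Qed.
End Instance.

(** * Counting the states of one query *)

Section QueryStateFinite.
Variables K d : nat.

Definition query_state_tuple (s : query_state K d) :=
  (cs_load s, cs_clock s, cs_bit0 s, cs_bit1 s, cs_rise s).

Definition tuple_query_state p : query_state K d :=
  let: (u, h, b0, b1, a) := p in QueryState u h b0 b1 a.

Lemma query_state_tupleK : cancel query_state_tuple tuple_query_state.
Proof. by case. Qed.

HB.instance Definition _ := Countable.copy (query_state K d) (can_type query_state_tupleK).
HB.instance Definition _ : isFinite (query_state K d) := CanIsFinite query_state_tupleK.

Lemma card_query_state : 0 < d -> #|{: query_state K d}| <= 2 ^ ((K + 6) * d).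
Proof.
move=> d0; apply: leq_trans (leq_card _ (can_inj query_state_tupleK)) _.
rewrite !card_prod !card_tuple !card_bool !card_ord.
(* The summands pay, in order, for the load, the clock, the two bit vectors and the rise bit. *)
have -> : (K + 6) * d = (K + 1) * d + (d + d) + d + d + d by lia.
have le2 : 2 <= 2 ^ d by rewrite -[X in X <= _]expn1 leq_pexp2l.
rewrite !expnD; apply: (leq_mul (leq_mul (leq_mul (leq_mul _ _) _) _) _) => //.
- apply: leq_trans (ltn_expl (K + d) (isT : 1 < 2)) _; rewrite leq_pexp2l //; nia.
- by apply: leq_trans (leq_mul le2 le2).
Qed.

End QueryStateFinite.

Lemma tuple_encoding (T : finType) m :
  #|T| <= 2 ^ m -> exists enc : T -> m.-tuple bool, injective enc.
Proof.
rewrite -card_bool -card_tuple => le_card.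
exists (fun x => enum_val (widen_ord le_card (enum_rank x))) => x y /enum_val_inj.
by move=> /(congr1 val) /= /val_inj /enum_rank_inj.
Qed.

(** * Cells of the average as integer inequalities *)

Lemma average_inl K n (x : {ffun 'I_n -> 'I_K.+1}) (k : 'I_K.+1) : 0 < n ->
  (average x \in cell_itv (inl k : cell K)) = (\sum_i (x i : nat) == n * k).
Proof.
move=> n0; rewrite in_itv /= /average -natr_sum.
rewrite ler_pdivlMr ?ltr0n // ler_pdivrMr ?ltr0n // -!natrM !ler_nat.
by rewrite mulnC eq_sym eqn_leq.
Qed.

Lemma average_inr K n (x : {ffun 'I_n -> 'I_K.+1}) (k : 'I_K) : 0 < n ->
  (average x \in cell_itv (inr k : cell K)) = (n * k < \sum_i (x i : nat) < n * k.+1).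
Proof.
move=> n0; rewrite in_itv /= /average -natr_sum.
rewrite ltr_pdivlMr ?ltr0n // ltr_pdivrMr ?ltr0n // -!natrM !ltr_nat.
by rewrite ![n * _]mulnC.
Qed.

(** * The complete algorithm: all queries in turn *)

Section Algorithm.
Variable K : nat.

Definition query := 'I_K.*2.+2.

Definition weight (q : query) (v : 'I_K.+1) : nat := if odd q then K - v else v.

Definition node_memory (d : nat) := ('I_5 * query * {ffun query -> query_state K d})%type.

Definition start d (v : 'I_K.+1) : node_memory d :=
  (ord0, ord0, [ffun q => QueryState (inord (weight q v)) ord0
                            [tuple false | _ < d] [tuple false | _ < d] false]).

(* With S the sum of the initial values, query [2k] asks whether [S < n * k], and
   query [2k+1] whether the sum of the [K - x_i] is less than [n * k]. *)
Definition below (b : query -> bool) (k : nat) : bool := b (inord k.*2).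
Definition above (b : query -> bool) (k : nat) : bool := b (inord (K - k).*2.+1).

(** The final [inl ord0] is a placeholder for inconsistent answers, which may occur before the
    queries settle. *)
Definition decode (b : query -> bool) : cell K :=
  if [pick k : 'I_K.+1 | ~~ below b k && ~~ above b k] is Some k then inl k
  else if [pick k : 'I_K | above b k && below b k.+1] is Some k then inr k
  else inl ord0.

(** The default memory cannot depend on the initial value, so [None] stands for [start d v] until
    the first transition. *)
Definition transition d (v : 'I_K.+1) (mem : option (node_memory d))
    (_ : option (cell K)) (msgs : d.-tuple (option bool)) :
    option (node_memory d) * option (cell K) * d.-tuple bool :=
  let: (r, q, tbl) := odflt (start d v) mem in
  let: (s, out) := phase q./2 r (tbl q) (listen msgs) in
  let tbl' := [ffun q' => if q' == q then s else tbl q'] in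
  (Some (if r == 4 :> nat then (ord0, ordS q, tbl') else (inord r.+1, q, tbl')),
   Some (decode (fun q' => cs_rise (tbl' q'))), out).

Definition averaging : algorithm 'I_K.+1 (cell K) :=
  Algorithm (fun=> None) transition.

Lemma averaging_storage : constant_storage averaging.
Proof.
(* Bits per link: 4 for the phase and the extra value [None], [Q] for the current query, [K + 6] for
   each of the [Q] table entries. *)
pose Q := K.*2.+2; exists (4 + Q + (K + 6) * Q) => d d0; apply: tuple_encoding.
rewrite card_option !card_prod card_ffun !card_ord -/Q.
have le1 : #|{: query_state K d}| ^ Q <= 2 ^ ((K + 6) * Q * d).
  by rewrite mulnAC expnM leq_exp2r // card_query_state.
have le2 : Q <= 2 ^ (Q * d).
  by apply: leq_trans (ltnW (ltn_expl Q (isT : 1 < 2))) _; rewrite leq_pexp2l //; nia.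
have le3 : 2 ^ 4 <= 2 ^ (4 * d) by rewrite leq_pexp2l //; lia.
have := leq_mul le2 le1; rewrite -expnD -mulnDl => ab.
rewrite -addnA mulnDl expnD -mulnA.
have b0 : 0 < 2 ^ ((Q + (K + 6) * Q) * d) by rewrite expn_gt0.
apply: leq_trans (leq_mul le3 (leqnn _)).
by apply: (@leq_ltn_trans (5 * 2 ^ ((Q + (K + 6) * Q) * d))); rewrite ?leq_mul2l ?ltn_mul2r ?b0.
Qed.

(** * Correctness and running time *)

Section Correctness.
Variables (n : nat) (N : network n) (x : {ffun 'I_n -> 'I_K.+1}).
Implicit Types (c : configuration averaging N) (q : query) (T : query -> nat).

Definition initial q (i : 'I_n) : nat := weight q (x i).

Lemma weight_le q v : weight q v <= K.
Proof. by rewrite /weight; case: ifP => _; [lia | rewrite -ltnS]. Qed.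

Lemma query_half q : q./2 <= K.
Proof. by have := ltn_ord q; lia. Qed.

Definition view c i : node_memory (degree N i) :=
  odflt (start _ (x i)) (st_mem (c i)).

(* Query [q] is being processed and is at phase [r] of its round; every query
   [q'] has gone through [T q'] full rounds. *)
Definition synced q r T c : Prop :=
  forall i, [/\ (view c i).1.1 = r :> nat, (view c i).1.2 = q,
    forall q', q' != q -> rest q'./2 (initial q') (T q') ((view c i).2 q') &
    stage q./2 (initial q) (T q) r ((view c i).2 q) (st_msg (c i))].

Lemma step_view q r T c i : synced q r T c ->
  let p := phase q./2 r ((view c i).2 q) (listen (gather (fun j => st_msg (c j)) i)) in
  let tbl := [ffun q' => if q' == q then p.1 else (view c i).2 q'] in
  [/\ view (step x c) i = if r == 4 then (ord0, ordS q, tbl) else (inord r.+1, q, tbl),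
      st_msg (step x c i) = utter p.2 &
      st_out (step x c i) = Some (decode (fun q' => cs_rise ((view (step x c) i).2 q')))].
Proof.
move=> /(_ i) [rE qE _ _]; rewrite /view /step /= /transition -/(view c i).
rewrite -[received c i]/(gather (fun j => st_msg (c j)) i).
move: rE qE; case: (view c i) => [[r' q'] tbl] /= -> ->.
by case: phase => s out /=; split=> //; case: ifP.
Qed.

Lemma step_active q r T c i : synced q r T c ->
  let p := phase q./2 r ((view c i).2 q) (listen (gather (fun j => st_msg (c j)) i)) in
  if r < 4 then stage q./2 (initial q) (T q) r.+1 p.1 (utter p.2)
  else rest q./2 (initial q) (T q).+1 p.1.
Proof.
move=> sc.
have st j : stage q./2 (initial q) (T q) r ((view c j).2 q) (st_msg (c j)).
  by case: (sc j).
exact: (stage_phase (query_half q) (fun j => weight_le q (x j)) i st).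
Qed.

Lemma step_synced q r T c : r < 4 -> synced q r T c -> synced q r.+1 T (step x c).
Proof.
move=> r4 sc i; have [-> -> _] := step_view i sc.
rewrite ltn_eqF //= inordK; last by lia.
split=> // [q' q'q|]; first by rewrite ffunE (negPf q'q); case: (sc i) => _ _ /(_ q' q'q).
rewrite ffunE eqxx.
by have := step_active i sc; rewrite r4.
Qed.

Lemma step_synced_last q T c : synced q 4 T c ->
  synced (ordS q) 0 (fun q' => T q' + (q' == q)) (step x c).
Proof.
move=> sc i; have [-> _ _] := step_view i sc.
have next_rest q' : rest q'./2 (initial q') (T q' + (q' == q))
    ([ffun q' => if q' == q then
       (phase q./2 4 ((view c i).2 q) (listen (gather (fun j => st_msg (c j)) i))).1
       else (view c i).2 q'] q').
  rewrite ffunE; case: eqP => [->|/eqP q'q]; last first.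
    by rewrite addn0; case: (sc i) => _ _ /(_ q' q'q).
  by rewrite addn1; exact: (step_active i sc).
by rewrite eqxx; split=> //; exact: next_rest.
Qed.

(** Closed form for the number of [j < m] congruent to [q] modulo [2K + 2]. *)
Definition rounds_done m q := (m + (K.*2.+1 - q)) %/ K.*2.+2.

Lemma conf_at_synced t : exists q T,
  [/\ synced q (t %% 5) T (conf_at averaging N x t), q = (t %/ 5) %% K.*2.+2 :> nat &
      forall q', T q' = rounds_done (t %/ 5) q'].
Proof.
elim: t => [|t [q [T [sc qE TE]]]].
  exists ord0, (fun=> 0); split=> // [i|q']; last first.
    by rewrite /rounds_done divn_small //; lia.
  have w_lt q' : weight q' (x i) < (K + degree N i).+1.
    by rewrite ltnS (leq_trans (weight_le _ _)) ?leq_addr.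
  by split=> // [q' _|]; split; rewrite //= ffunE //= inordK.
have [t4|t4] := ltnP (t %% 5) 4.
  exists q, T; have -> : t.+1 %% 5 = (t %% 5).+1 by lia.
  have -> : t.+1 %/ 5 = t %/ 5 by lia.
  by split=> //; exact: step_synced.
exists (ordS q), (fun q' => T q' + (q' == q)).
have -> : t.+1 %% 5 = 0 by lia.
have -> : t.+1 %/ 5 = (t %/ 5).+1 by lia.
split.
- by apply: step_synced_last; have <- : t %% 5 = 4 by lia.
- by rewrite /= qE -addn1 modnDml addn1.
(* The quotient grows exactly when [2K + 2] divides the new numerator, that is, when [q'] is the
   query just finished. *)
move=> q'; rewrite TE /rounds_done addSn divnS // addnC; congr (nat_of_bool _ + _).
rewrite -addnS -subSn; last by have := ltn_ord q'; lia.
rewrite addnBA; last exact/ltnW/ltn_ord.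
rewrite -eqn_mod_dvd; last by have := ltn_ord q'; lia.
by rewrite modnDr (modn_small (ltn_ord q')) -qE eq_sym.
Qed.

Definition settle_time := n.*2.+2 * (n * K).+1 + n.

(** The strict bound on [T] allows for a bit that dates from step [T q' - 1]. *)
Lemma cs_rise_settled q r T c i q' : (forall q', settle_time < T q') -> synced q r T c ->
  cs_rise ((view c i).2 q') = (\sum_i weight q' (x i) < n * q'./2).
Proof.
move=> T_gt sc.
have settled t : settle_time <= t ->
    rises N q'./2 (initial q') t i = (\sum_i weight q' (x i) < n * q'./2).
  by apply: rises_eventually; exact: query_half.
have Tq' := T_gt q'; case: (sc i) => _ _ /(_ q').
have [q'q _|_ /(_ isT) [_ _ aE] _] := eqVneq q' q; last by rewrite aE ?settled; lia.
rewrite -q'q => /(stage_rise (leq_ltn_trans (leq0n _) Tq')) [t tT ->].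
by apply: settled; lia.
Qed.

Lemma decode_correct (b : query -> bool) : 0 < n ->
  (forall q, b q = (\sum_i weight q (x i) < n * q./2)) ->
  decode b = interval_avg x.
Proof.
move=> n0 bE; set S := \sum_i (x i : nat).
have belowE k : k <= K -> below b k = (S < n * k).
  move=> kK; rewrite /below bE inordK ?ltnS ?leqW ?leq_double // doubleK.
  congr (_ < _); apply: eq_bigr => i _.
  by rewrite /weight inordK ?odd_double // ltnS leqW // leq_double.
have sumC : \sum_i (K - x i) + S = n * K.
  rewrite -big_split -[n in RHS]card_ord -sum_nat_const; apply: eq_bigr => i _ /=.
  by rewrite subnK // -ltnS.
have aboveE k : k <= K -> above b k = (n * k < S).
  move=> kK; have lt : (K - k).*2.+1 < K.*2.+2 by lia.
  rewrite /above bE inordK //= uphalf_double.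
  rewrite (eq_bigr (fun i => K - x i)); last first.
    by move=> i _; rewrite /weight inordK //= odd_double.
  have nK : n * (K - k) + n * k = n * K by rewrite -mulnDr subnK.
  by move: sumC nK; move: (\sum_i _) (n * (K - k)) (n * k) => a b' c; lia.
rewrite /decode; case: pickP => [k|none].
  have kK : k <= K by rewrite -ltnS.
  rewrite belowE // aboveE // => kS; apply/esym/interval_avgP.
  by rewrite average_inl // -/S; lia.
have [y yx] := average_cell x; have -> := (interval_avgP x y).1 yx.
case: y yx => k; first rewrite average_inl // => /eqP SE.
  have kK : k <= K by rewrite -ltnS.
  by have := none k; rewrite belowE // aboveE // /S SE ltnn.
rewrite average_inr // -/S => kS.
have ltk (k' : 'I_K) : k' <= K by exact/ltnW/ltn_ord.
case: pickP => [k'|/(_ k)]; last by rewrite belowE // aboveE // kS.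
rewrite belowE // aboveE // => k'S; congr inr; apply/val_inj => /=.
suff : k < k'.+1 /\ k' < k.+1 by lia.
by split; rewrite -(ltn_pmul2l n0); lia.
Qed.

Lemma averaging_correct t i : 0 < K -> 120 * (n ^ 2 * K ^ 2) <= t ->
  output_at averaging N x t i = Some (interval_avg x).
Proof.
move=> K0; have n1 := net_size N; case: t => [|t t_ge].
  (* At time 0 the output is still [None]; positivity of [n] and [K] excludes this time. *)
  by rewrite leqNgt !muln_gt0; lia.
have [q [T [sc _ _]]] := conf_at_synced t.
have [q' [T' [sc' _ TE]]] := conf_at_synced t.+1.
rewrite /output_at /conf_at iterS.
have [_ _ ->] := step_view i sc; congr Some; apply: decode_correct; first by lia.
move=> q0; apply: cs_rise_settled sc' => q1; rewrite TE /rounds_done leq_divRL //.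
apply: leq_trans (leq_addr _ _).
rewrite leq_divRL // -mulnA; apply: leq_trans t_ge.
(* The constant is 120 = 6 * 20: a step of all queries takes [5 * (2K + 2) <= 20 * K] rounds. *)
have le_settle : settle_time.+1 <= 6 * (n * n * K).
  have nK : n <= n * K by rewrite leq_pmulr.
  have nnK : 2 * (n * K) <= n * n * K by rewrite -mulnA leq_mul2r n1 orbT.
  by rewrite /settle_time; nia.
apply: (leq_trans (leq_mul le_settle (_ : _ <= 20 * K))); first by lia.
by rewrite -!mulnn; lia.
Qed.

End Correctness.
End Algorithm.

(** * The real bound with the logarithm *)

Local Open Scope ring_scope.

Theorem theorem8p1 (R : realType) :
  (forall K : nat, (1 <= K)%N ->
     computable_with_constant_storage (@interval_avg K))
  /\
  (exists C : R, forall K : nat, (2 <= K)%N ->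
     exists A : algorithm 'I_K.+1 (cell K),
       constant_storage A /\
       forall (n : nat) (N : network n) (x : {ffun 'I_n -> 'I_K.+1}) (t : nat),
         C * n%:R ^+ 2 * K%:R ^+ 2 * ln (K%:R : R) <= t%:R ->
         forall i : 'I_n, output_at A N x t i = Some (interval_avg x)).
Proof.
split=> [K K1|].
  exists (averaging K); split; first exact: averaging_storage.
  move=> n N x; exists (120 * (n ^ 2 * K ^ 2))%N => t t_ge i.
  exact: averaging_correct.
have ln2 : 0 < ln (2 : R) by rewrite ln_gt0 // ltr1n.
(* For [K >= 2] the factor [ln K / ln 2] is at least 1, so the bound dominates
   [120 * n ^ 2 * K ^ 2]. *)
exists (120 / ln 2) => K K2; exists (averaging K); split; first exact: averaging_storage.
move=> n N x t t_ge i; apply: averaging_correct; first exact: leq_trans K2.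
rewrite -(ler_nat R) natrM natrM !natrX; apply: le_trans t_ge.
have lnK : 1 <= ln (K%:R : R) / ln 2.
  by rewrite ler_pdivlMr // mul1r ler_ln ?posrE ?ltr0n ?ler_nat // (leq_trans _ K2).
have -> : 120 / ln 2 * n%:R ^+ 2 * K%:R ^+ 2 * ln K%:R =
    120 * (n%:R ^+ 2 * K%:R ^+ 2) * (ln K%:R / ln 2) :> R by ring.
by rewrite ler_peMr // !mulr_ge0 // exprn_ge0.
Qed.
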